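(* Let $K=\mathbb{F}_q$ be a finite field, let $s\geq 1$ and $1\leq d\leq s$ be integers, and let $\mathcal{C}_{\leq d}$ be the squarefree evaluation code of degree $d$ on the affine torus $T=(\mathbb{F}_q^* )^s$. If $q\geq 3$, then the minimum distance $\delta(\mathcal{C}_{\leq d})$ of $\mathcal{C}_{\leq d}$ is $(q-2)^{d}(q-1)^{s-d}$.
   Context: Let $S=K[t_1,\ldots,t_s]$, let $V_{\leq d}$ be the set of all squarefree monomials of $S$ of degree at most $d$ (including $1$), and let $KV_{\leq d}$ be its $K$-span. Write $T=\{P_1,\ldots,P_m\}$. The squarefree evaluation code $\mathcal{C}_{\leq d}\subset K^m$ of degree $d$ on $T$ is the image of $KV_{\leq d}\to K^m$, $f\mapsto(f(P_1),\ldots,f(P_m))$. The minimum distance of a linear code is the minimum number of nonzero entries of a nonzero codeword. *)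

(* Defs.v *)
From mathcomp Require Import all_boot all_order all_algebra.
From mathcomp Require Import mpoly.
Set Implicit Arguments.
Unset Strict Implicit.
Unset Printing Implicit Defensive.
Import Order.TTheory GRing.Theory.
Local Open Scope ring_scope.

Definition hamming_weight (K : finFieldType) (m : nat) (c : 'rV[K]_m) : nat :=
  #|[set i | c 0 i != 0]|.

(* The neutral element m of the minimum is never smaller than a weight, so it
   matters only for the zero code, whose minimum distance is m by convention;
   see min_distanceP. *)
Definition min_distance (K : finFieldType) (m : nat) (C : {set 'rV[K]_m}) : nat :=
  \big[minn/m]_(c in C | c != 0) hamming_weight c.

Definition squarefree_mnm (s : nat) (u : 'X_{1..s}) : bool :=
  [forall i, (u i <= 1)%N].

(* The K-linear combination, with coefficients a, of the squarefree monomials of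
   degree at most d; the range of this map is the space K V_{<= d}. *)
Definition squarefree_comb (K : finFieldType) (s d : nat)
    (a : {ffun 'X_{1..s < d.+1} -> K}) : {mpoly K[s]} :=
  \sum_(u : 'X_{1..s < d.+1} | squarefree_mnm u) a u *: 'X_[u].

(* The points of T are P_1, ..., P_m in the order of enum T. *)
Definition eval_on (K : finFieldType) (s : nat) (T : {set {ffun 'I_s -> K}})
    (f : {mpoly K[s]}) : 'rV[K]_#|T| :=
  \row_(j < #|T|) f.@[enum_val j].

Definition squarefree_code (K : finFieldType) (s : nat)
    (T : {set {ffun 'I_s -> K}}) (d : nat) : {set 'rV[K]_#|T|} :=
  [set eval_on T (squarefree_comb a) | a : {ffun 'X_{1..s < d.+1} -> K}].

Definition affine_torus (K : finFieldType) (s : nat) : {set {ffun 'I_s -> K}} :=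
  [set P : {ffun 'I_s -> K} | [forall i, P i != 0]].

Lemma min_distanceP (K : finFieldType) (m : nat) (C : {set 'rV[K]_m}) :
    (exists2 c, c \in C & c != 0) ->
  (exists c, [/\ c \in C, c != 0 & hamming_weight c = min_distance C]) /\
  (forall c, c \in C -> c != 0 -> (min_distance C <= hamming_weight c)%N).
Proof.
move=> [c0 c0C c0n0].
have lb c : c \in C -> c != 0 -> (min_distance C <= hamming_weight c)%N.
  move=> cC cn0; rewrite /min_distance -minEnat -leEnat.
  by apply: bigmin_le_cond; rewrite cC.
split=> //.
have [e|//] : min_distance C = m \/
  (exists c, [/\ c \in C, c != 0 & hamming_weight c = min_distance C]).
  rewrite /min_distance.
  apply: (big_ind (fun n => n = m \/
    exists c, [/\ c \in C, c != 0 & hamming_weight c = n])); first by left.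
    by move=> x y hx hy; rewrite /minn; case: ifP.
  by move=> c /andP[cC cn0]; right; exists c.
exists c0; split=> //; apply/eqP; rewrite eqn_leq lb // andbT e.
by rewrite -[leqRHS]card_ord max_card.
Qed.

(* Main.v *)
(* Write a squarefree polynomial as f = sum_A a_A t^A over subsets A of the
   variables, and let N(f) be its number of nonzeros on the torus. Since
   f = g + t_i h with g and h = df/dt_i free of t_i, (q - 1) N(f) >= (q - 2) N(h).
   Differentiating along a set S of maximal size with a_S != 0 leaves the nonzero
   constant a_S, so (q - 1)^|S| N(f) >= (q - 2)^|S| (q - 1)^s, where |S| <= d.
   Equality is attained by (t_1 - 1) ... (t_d - 1). *)

Require Import Defs.
From mathcomp Require Import all_boot all_order all_algebra.
From mathcomp Require Import mpoly.

Set Implicit Arguments.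
Unset Strict Implicit.
Unset Printing Implicit Defensive.

Import GRing.Theory.

Section SquarefreePolynomials.

Local Open Scope ring_scope.

Variables (K : finFieldType) (s : nat).
Implicit Types (a b : {set 'I_s} -> K) (P : {ffun 'I_s -> K}).

(** * Squarefree polynomials as coefficient families on sets of variables *)

Definition sf_eval a P : K := \sum_A a A * \prod_(i in A) P i.

Definition sf_nonzeros a : {set {ffun 'I_s -> K}} :=
  [set P in affine_torus K s | sf_eval a P != 0].

(* The coefficients of the partial derivative with respect to t_i. *)
Definition sf_deriv (i : 'I_s) a (A : {set 'I_s}) : K :=
  if i \in A then 0 else a (i |: A).

Definition update P (i : 'I_s) (t : K) : {ffun 'I_s -> K} :=
  [ffun j => if j == i then t else P j].

Lemma update_torus P i t :
  P \in affine_torus K s -> t != 0 -> update P i t \in affine_torus K s.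
Proof.
rewrite !inE => /forallP PT tn0; apply/forallP => j.
by rewrite ffunE; case: ifP.
Qed.

(** Every monomial has degree at most 1 in t_i: the sets avoiding i give the value at t_i = 0, and
    removing i from the others gives the derivative. The latter does not involve t_i, so it may be
    evaluated at [P] itself. *)
Lemma sf_eval_update a P i t :
  sf_eval a (update P i t) = sf_eval a (update P i 0) + t * sf_eval (sf_deriv i a) P.
Proof.
have prodE u (A : {set 'I_s}) : i \notin A ->
    \prod_(j in A) update P i u j = \prod_(j in A) P j.
  move=> iA; apply: eq_bigr => j jA; rewrite ffunE; case: eqP => // ji.
  by rewrite -ji jA in iA.
have splitE u : sf_eval a (update P i u) =
    \sum_(A : {set 'I_s} | i \notin A) a A * \prod_(j in A) P j
    + u * sf_eval (sf_deriv i a) P.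
  rewrite /sf_eval (bigID (fun A : {set 'I_s} => i \notin A)) /=; congr (_ + _).
    by apply: eq_bigr => A iA; rewrite prodE.
  rewrite mulr_sumr [RHS](bigID (fun A : {set 'I_s} => i \notin A)) /=.
  rewrite [X in _ = _ + X]big1 ?addr0; last first.
    by move=> A /negPn iA; rewrite /sf_deriv iA mul0r mulr0.
  rewrite (reindex_onto (fun A => i |: A) (fun A => A :\ i)) /=; last first.
    by move=> A /negPn iA; rewrite setD1K.
  apply: eq_big => [A | A].
    rewrite setU11 /=; apply/eqP/idP => [<- | iA]; first by rewrite !inE eqxx.
    by rewrite setU1K.
  rewrite negbK => /andP[_ /eqP e].
  have iA : i \notin A by rewrite -e !inE eqxx.
  rewrite /sf_deriv (negbTE iA) big_setU1 //= ffunE eqxx prodE //.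
  by rewrite mulrCA.
by rewrite !splitE mul0r addr0.
Qed.

(** * Lower bound for the number of nonzeros on the torus *)

Lemma card_units : #|[set t : K | t != 0]| = (#|K| - 1)%N.
Proof. by rewrite cardsE cardC1 subn1. Qed.

(** Besides 0, only the root - x / y is lost, and the two may coincide. *)
Lemma card_affine_nonzeros (x y : K) : y != 0 ->
  (#|K| - 2 <= #|[set t : K | (t != 0%R) && (x + t * y != 0)%R]|)%N.
Proof.
move=> yn0.
have sub : ~: [set 0; - x / y] \subset [set t : K | (t != 0) && (x + t * y != 0)].
  apply/subsetP => t; rewrite !inE negb_or => /andP[-> /= tn].
  apply: contra tn => /eqP e; apply/eqP.
  by apply: (mulIf yn0); rewrite divfK //; apply/eqP; rewrite -addr_eq0 addrC e.
apply: leq_trans (subset_leq_card sub).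
rewrite cardsCs setCK leq_sub2l // cards2; by case: eqP.
Qed.

(* Double counting of the pairs (P, t) with f (P[i := t]) != 0: swapping t with
   P i shows that there are (q - 1) * N(f) of them, and each P where
   the derivative does not vanish allows at least q - 2 values of t. *)
Lemma card_nonzeros_deriv i a :
  ((#|K| - 2) * #|sf_nonzeros (sf_deriv i a)|
    <= (#|K| - 1) * #|sf_nonzeros a|)%N.
Proof.
pose X := [set w : {ffun 'I_s -> K} * K |
  [&& w.1 \in affine_torus K s, w.2 != 0 & sf_eval a (update w.1 i w.2) != 0]].
pose swap (w : {ffun 'I_s -> K} * K) := (update w.1 i w.2, w.1 i).
have swapK : involutive swap.
  move=> [P t]; rewrite /swap /= ffunE eqxx; congr pair.
  by apply/ffunP => j; rewrite !ffunE; case: eqP => // ->.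
have XE : #|X| = ((#|K| - 1) * #|sf_nonzeros a|)%N.
  rewrite mulnC -card_units -cardsX.
  (* [swap] turns [X] into the set of all pairs of a nonzero of f on the torus and a unit: the
     updated point is the nonzero, the old coordinate is the free unit. *)
  rewrite -(card_imset _ (inv_inj swapK)); apply: eq_card => -[P t].
  apply/imsetP/idP => [[[Q u]] | ].
    rewrite !inE /= => /and3P[QT un0 nz] [-> ->].
    have := @update_torus Q i u; rewrite !inE => /(_ QT un0) -> /=.
    by rewrite nz; move/forallP: QT => ->.
  rewrite !inE /= => /andP[/andP[PT nz] tn0].
  exists (swap (P, t)); last by rewrite swapK.
  have := @update_torus P i t; rewrite !inE /= => /(_ PT tn0) ->.
  move/forallP: (PT) => -> /=.
  by have := swapK (P, t); rewrite {1}/swap => -[-> _].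
(* The same pairs, now counted fibre by fibre over [P]. *)
have {}XE : \sum_(P in affine_torus K s)
    \sum_(t : K | (t != 0%R) && (sf_eval a (update P i t) != 0%R)) 1%N
    = ((#|K| - 1) * #|sf_nonzeros a|)%N.
  by rewrite -XE pair_big_dep -sum1_card; apply: eq_bigl => w; rewrite [in RHS]inE.
rewrite -XE.
rewrite mulnC -sum_nat_const.
rewrite (eq_bigl (fun P => (P \in affine_torus K s) &&
   (sf_eval (sf_deriv i a) P != 0))); last by move=> P; rewrite inE.
rewrite big_mkcondr; apply: leq_sum => P _; case: ifP => // nz.
rewrite sum1dep_card; apply: leq_trans (card_affine_nonzeros _ nz) _.
by apply/eq_leq/eq_card => t; rewrite !inE sf_eval_update.
Qed.

Lemma card_torus : #|affine_torus K s| = ((#|K| - 1) ^ s)%N.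
Proof.
have := card_ffun_on 'I_s [set t : K | t != 0].
rewrite card_ord card_units => <-; apply: eq_card => P.
by rewrite inE; apply: eq_forallb => i; rewrite inE.
Qed.

(** Induction on the size of [S], differentiating along some i in [S]. The set [S :\ i] is maximal
    for the derivative: if A avoids i and properly contains it, then A with i added properly
    contains [S]. For empty [S], f is a nonzero constant. *)
Lemma card_nonzeros_max (S : {set 'I_s}) a :
  a S != 0 -> (forall A : {set 'I_s}, S \proper A -> a A = 0) ->
  ((#|K| - 2) ^ #|S| * (#|K| - 1) ^ s <= (#|K| - 1) ^ #|S| * #|sf_nonzeros a|)%N.
Proof.
move En: #|S| => n; elim: n S En a => [|n IHn] S En a aS maxS.
  have S0 : S = set0 by apply/eqP; rewrite -cards_eq0 En.
  rewrite S0 in aS maxS *; rewrite !expn0 !mul1n -card_torus.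
  apply/eq_leq/eq_card => P; rewrite [RHS]inE.
  rewrite /sf_eval (bigD1 set0) //= big_set0 mulr1 big1 ?addr0 ?aS ?andbT //.
  by move=> A A0; rewrite maxS ?mul0r // proper0.
have [i iS] : exists i, i \in S by apply/set0Pn; rewrite -card_gt0 En.
have cS : #|S :\ i| = n by apply/eqP; rewrite -eqSS -En (cardsD1 i S) iS.
have step : ((#|K| - 2) ^ n * (#|K| - 1) ^ s
    <= (#|K| - 1) ^ n * #|sf_nonzeros (sf_deriv i a)|)%N.
  apply: (IHn _ cS); first by rewrite /sf_deriv !inE eqxx /= setD1K.
  move=> A SA; rewrite /sf_deriv; case: ifPn => // iA; apply: maxS.
  by rewrite -(setD1K iS) properEcard setUS ?proper_sub //= !cardsU1 iA !inE
     eqxx ltnS proper_card.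
rewrite !expnS -!mulnA.
apply: leq_trans (leq_mul (leqnn (#|K| - 2)%N) step) _.
rewrite mulnCA [leqRHS]mulnCA.
by rewrite leq_mul // card_nonzeros_deriv.
Qed.

(** A set of maximal size in the support is maximal for inclusion. Cancelling (q - 1)^|S| gives the
    bound with |S| in place of d, which is at least the one with d because q - 2 <= q - 1. *)
Lemma card_nonzeros_ge d a :
  (d <= s)%N -> (exists A, a A != 0) -> (forall A, a A != 0 -> (#|A| <= d)%N) ->
  ((#|K| - 2) ^ d * (#|K| - 1) ^ (s - d) <= #|sf_nonzeros a|)%N.
Proof.
move=> ds [A0 aA0] deg_a.
pose S := [arg max_(A > A0 | a A != 0) #|A|].
have [aS maxS] : a S != 0 /\ forall A, a A != 0 -> (#|A| <= #|S|)%N.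
  by rewrite /S; case: arg_maxnP.
have q1 : (0 < #|K| - 1)%N by rewrite subn_gt0 card_finNzRing_gt1.
have Sd := deg_a _ aS; have Ss := leq_trans Sd ds.
have := card_nonzeros_max aS.
rewrite -[X in (_ * _ ^ X)%N](subnKC Ss) expnD mulnCA leq_pmul2l ?expn_gt0 ?q1 //.
move=> H; apply: leq_trans (H _); last first.
  by move=> A /proper_card SA; apply/eqP/negPn/negP => /maxS; rewrite leqNgt SA.
rewrite -[X in (_ ^ X * _ <= _)%N](subnKC Sd) expnD -mulnA leq_mul //.
have -> : (s - #|S| = (d - #|S|) + (s - d))%N by rewrite addnC addnBA // subnK.
rewrite expnD leq_mul //; have [-> // | e_gt0] := posnP (d - #|S|)%N.
by rewrite leq_exp2r // leq_sub2l.
Qed.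

(** * Passage between squarefree monomials and sets of variables *)

Definition mnm_supp (u : 'X_{1..s}) : {set 'I_s} := [set i | u i != 0%N].

(** At most one squarefree [u] has support [A]; the sum selects its coefficient and is 0 when |A|
    exceeds d. *)
Definition sf_coef d (c : {ffun 'X_{1..s < d.+1} -> K}) (A : {set 'I_s}) : K :=
  \sum_(u : 'X_{1..s < d.+1} | squarefree_mnm u && (mnm_supp u == A)) c u.

Lemma mdeg_squarefree (u : 'X_{1..s}) : squarefree_mnm u -> mdeg u = #|mnm_supp u|.
Proof.
move=> /forallP sf; rewrite mdegE -sum1_card [RHS]big_mkcond /=.
by apply: eq_bigr => i _; rewrite inE; have := sf i; case: (u i) => [|[]].
Qed.

Lemma meval_squarefree_comb d (c : {ffun 'X_{1..s < d.+1} -> K}) P :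
  (squarefree_comb c).@[P] = sf_eval (sf_coef c) P.
Proof.
rewrite /squarefree_comb raddf_sum /=.
rewrite (partition_big (fun u : 'X_{1..s < d.+1} => mnm_supp u) xpredT) //=.
apply: eq_bigr => A _; rewrite /sf_coef mulr_suml.
apply: eq_bigr => u /andP[/forallP sf /eqP <-]; rewrite mevalZ mevalX; congr (_ * _).
rewrite [RHS]big_mkcond; apply: eq_bigr => i _; rewrite inE.
by have := sf i; case: (u i : nat) => [|[|]].
Qed.

Lemma sf_coef_deg d (c : {ffun 'X_{1..s < d.+1} -> K}) A :
  sf_coef c A != 0 -> (#|A| <= d)%N.
Proof.
apply: contraNT; rewrite -ltnNge => dA; rewrite /sf_coef big_pred0 // => u.
apply/negbTE/negP => /andP[sf /eqP uA].
by have := bmdeg u; rewrite mdeg_squarefree // uA ltnS leqNgt dA.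
Qed.

(** The indicator exponent of [A] is the only squarefree one with support [A]. *)
Lemma sf_coef_surj d b :
  (forall A, b A != 0 -> (#|A| <= d)%N) ->
  exists c : {ffun 'X_{1..s < d.+1} -> K}, sf_coef c =1 b.
Proof.
move=> deg_b; exists [ffun u : 'X_{1..s < d.+1} => b (mnm_supp u)] => A.
rewrite /sf_coef (eq_bigr (fun=> b A)); last first.
  by move=> u /andP[_ /eqP <-]; rewrite ffunE.
(* The degree bound, needed to form [BMultinom dv], is known only where [b A] is nonzero. *)
have [-> | bA] := eqVneq (b A) 0; first by rewrite big1.
pose v : 'X_{1..s} := [multinom (i \in A : nat) | i < s].
have sfv : squarefree_mnm v by apply/forallP => i; rewrite mnmE; case: (i \in A).
have suppv : mnm_supp v = A by apply/setP => i; rewrite inE mnmE; case: (i \in A).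
have dv : (mdeg v < d.+1)%N by rewrite mdeg_squarefree // suppv ltnS deg_b.
rewrite (big_pred1 (BMultinom dv)) // => u.
apply/andP/eqP => [[/forallP sfu /eqP uA] | ->]; last by rewrite /= suppv.
apply/val_inj/mnmP => i /=; rewrite mnmE -uA inE.
by have := sfu i; case: (u i : nat) => [|[|]].
Qed.

(** * The extremal polynomial *)

(* The coefficients of the product of the t_i - 1 for i < d. *)
Definition sf_extremal d (A : {set 'I_s}) : K :=
  \prod_i (if i \in A then (i < d)%:R else if (i < d)%N then -1 else 1).

(** A nonzero coefficient forces all indices in [A] to be below d. *)
Lemma sf_extremal_deg d A : sf_extremal d A != 0 -> (#|A| <= d)%N.
Proof.
move=> nz; rewrite cardE -(size_map val) -(size_iota 0 d).
apply: uniq_leq_size; first by rewrite (map_inj_uniq val_inj) enum_uniq.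
move=> _ /mapP[i iA ->]; rewrite mem_iota /= add0n; move: iA; rewrite mem_enum => iA.
by apply: contraNT nz => /negbTE id; rewrite /sf_extremal (bigD1 i) //= iA id mul0r.
Qed.

Lemma sf_eval_extremal d P :
  sf_eval (sf_extremal d) P = \prod_(i < s) (if (i < d)%N then P i - 1 else 1).
Proof.
(* Each factor is written as a coefficient times t_i plus a constant, so that expanding the product
   over subsets yields [sf_extremal]. *)
rewrite (eq_bigr (fun i : 'I_s => (i < d)%:R * P i + if (i < d)%N then -1 else 1)).
  rewrite bigA_distr; apply: eq_bigr => A _.
  rewrite /sf_extremal [X in _ * X]big_mkcond -big_split /=.
  by apply: eq_bigr => i _; case: ifP; rewrite ?mulr1.
by move=> i _; case: ifP; rewrite ?mul1r // mul0r add0r.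
Qed.

(** The nonzeros form a box: each coordinate below d avoids 0 and 1, the others only 0. *)
Lemma card_nonzeros_extremal d : (d <= s)%N ->
  #|sf_nonzeros (sf_extremal d)| = ((#|K| - 2) ^ d * (#|K| - 1) ^ (s - d))%N.
Proof.
move=> ds.
pose F (i : 'I_s) := [pred t : K | (t != 0) && ((i < d)%N ==> (t != 1))].
have cF i : #|F i| = (if i < d then #|K| - 2 else #|K| - 1)%N.
  case: ifP => id; last first.
    by rewrite -card_units; apply: eq_card => t; rewrite !inE id andbT.
  rewrite -(cardC (pred2 (0 : K) 1)) card2 eq_sym oner_eq0 addKn.
  by apply: eq_card => t; rewrite !inE id negb_or.
transitivity #|family F|.
  apply: eq_card => P; rewrite inE sf_eval_extremal inE.
  apply/andP/familyP => [[/forallP PT /prodf_neq0 nz] i | PF].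
    rewrite inE PT /=; apply/implyP => id.
    by have := nz i isT; rewrite id subr_eq0.
  split; first by apply/forallP => i; have := PF i; rewrite inE => /andP[].
  apply/prodf_neq0 => i _; case: ifP => id; last exact: oner_neq0.
  by have := PF i; rewrite inE id subr_eq0 => /andP[].
rewrite card_family foldrE big_map big_enum /=.
rewrite (eq_bigr _ (fun i _ => cF i)).
rewrite -(big_mkord xpredT (fun i => if i < d then #|K| - 2 else #|K| - 1)%N).
rewrite (big_cat_nat (n := d)) //=; congr (_ * _)%N.
  rewrite (eq_big_nat _ _ (F2 := fun=> #|K| - 2)%N) ?prod_nat_const_nat ?subn0 //.
  by move=> i /andP[_ ->].
rewrite (eq_big_nat _ _ (F2 := fun=> #|K| - 1)%N) ?prod_nat_const_nat //.
by move=> i /andP[di _]; rewrite ltnNge di.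
Qed.

End SquarefreePolynomials.

(** * Codeword weights and the minimum distance *)

Lemma hamming_weight_eval_on (K : finFieldType) (s : nat)
    (T : {set {ffun 'I_s -> K}}) (f : {mpoly K[s]}) :
  hamming_weight (eval_on T f) = #|[set P in T | f.@[P] != 0%R]|.
Proof.
rewrite /hamming_weight -(card_imset _ (@enum_val_inj _ (mem T))).
apply: eq_card => P; apply/imsetP/idP => [[j] | ].
  by rewrite !inE mxE => nz ->; rewrite enum_valP.
rewrite inE => /andP[PT nz]; exists (enum_rank_in PT P); last by rewrite enum_rankK_in.
by rewrite inE mxE enum_rankK_in.
Qed.

Theorem theorem5p5 (K : finFieldType) (s d : nat)
    (hs : 1 <= s) (hd : 1 <= d <= s) (hq : 3 <= #|K|) :
  min_distance (squarefree_code (affine_torus K s) d) =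
    (#|K| - 2) ^ d * (#|K| - 1) ^ (s - d).
Proof.
have /andP[_ ds] := hd.
set C := squarefree_code _ _; set N := _ * _.
(* Here q >= 3 enters: positivity of q - 2 makes the extremal codeword nonzero. *)
have N_gt0 : 0 < N by rewrite muln_gt0 !expn_gt0 !subn_gt0 hq ltnW.
have weightE (c : {ffun 'X_{1..s < d.+1} -> K}) :
    hamming_weight (eval_on (affine_torus K s) (squarefree_comb c))
      = #|sf_nonzeros (sf_coef c)|.
  rewrite hamming_weight_eval_on; apply: eq_card => P.
  by rewrite !inE meval_squarefree_comb.
have weight_neq0 m (v : 'rV[K]_m) : 0 < hamming_weight v -> v != 0%R.
  by apply: contraTneq => ->; rewrite lt0n negbK cards_eq0; apply/eqP/setP => i;
     rewrite !inE mxE eqxx.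
have [c0 c0E] := sf_coef_surj (@sf_extremal_deg K s d).
pose v0 := eval_on (affine_torus K s) (squarefree_comb c0).
have wv0 : hamming_weight v0 = N.
  rewrite weightE /N -card_nonzeros_extremal //; apply: eq_card => P.
  by rewrite !inE /sf_eval (eq_bigr _ (fun A _ => congr1 (GRing.mul^~ _) (c0E A))).
have v0C : v0 \in C by apply: imset_f.
have v0n0 : v0 != 0%R by rewrite weight_neq0 // wv0.
have [[v [vC vn0 wv]] minC] := min_distanceP (ex_intro2 _ _ v0 v0C v0n0).
apply/eqP; rewrite eqn_leq; apply/andP; split; first by rewrite -wv0 minC.
rewrite -wv; case/imsetP: vC vn0 => c _ -> vn0; rewrite weightE.
apply: card_nonzeros_ge => //; last exact: sf_coef_deg.
(* If all coefficients vanished, the codeword would be zero. *)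
apply/existsP; apply: contraR vn0 => /existsPn c_eq0.
apply/eqP/rowP => j; rewrite !mxE meval_squarefree_comb /sf_eval big1 // => A _.
by rewrite (eqP (negPn (c_eq0 A))) GRing.mul0r.
Qed.
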